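(* Let $\vec v=(y_1,\dots,y_n)^T\in\mathbb{R}_+^n$ be a basis of the number field $\mathbb{Q}(y_1)$ (as a vector space over $\mathbb{Q}$), and suppose $\vec v$ has an eventually periodic expansion in a unimodular Jacobi--Perron type MCF algorithm. Let $M$ be a matrix of repetend of this expansion. Then \[ M=(T_\varepsilon^{\vec v})^T \] for some unit $\varepsilon\in U(\mathcal{O}_{\mathbb{Q}(y_1)})$, where $T_\varepsilon^{\vec v}$ is the matrix of the $\mathbb{Q}$-linear map $x\mapsto\varepsilon x$ on $\mathbb{Q}(y_1)$ in the basis $\vec v$.
   Context: $\mathbb{R}_+$ denotes the positive reals; $\mathcal{O}_K$ is the ring of integers of $K$ and $U(\mathcal O_K)$ its unit group. The matrix of a linear map in the basis $\vec v$ has as $i$-th column the coordinate vector of the image of $v_i$. A Jacobi--Perron type MCF algorithm is given by an at most countable family $\mathcal I=\{I_1,I_2,\dots\}$ of pairwise disjoint subsets of $\mathbb{R}_+^n$ with $\alpha I\subseteq I$ for all $\alpha>0$, $I\in\mathcal I$, and a family $\mathcal A=\{A_1,A_2,\dots\}$ (same index set) of invertible real $n\times n$ matrices such that no product of matrices from $\mathcal A$ equals the identity. Given $\vec v\in\mathbb{R}_+^n$, set $\vec v^{(0)}=\vec v$; at step $i$, if $\vec v^{(i)}\in I_j$ set $A^{(i)}=A_j$ and $\vec v^{(i+1)}=A_j^{-1}\vec v^{(i)}$ (if $\vec v^{(i)}$ lies in no $I_j$, stop). The sequence $(A^{(i)})$ is the expansion of $\vec v$. The algorithm is unimodular if all matrices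 of $\mathcal A$ are integer matrices with determinant $\pm1$. The expansion is eventually periodic if there exist $N\ge0$, $p\ge1$ and real $\lambda$ with $\vec v^{(N)}=\lambda\vec v^{(N+p)}$; then, with $R=A^{(0)}\cdots A^{(N-1)}$ and $P=A^{(N)}\cdots A^{(N+p-1)}$, the matrix $RPR^{-1}$ is called a matrix of repetend. *)

(* Defs.v *)
From HB Require Import structures.
From mathcomp Require Import all_boot all_order all_algebra.
From mathcomp Require Import boolp classical_sets reals.

Set Implicit Arguments.
Unset Strict Implicit.
Unset Printing Implicit Defensive.

Import Order.TTheory GRing.Theory Num.Theory.
Local Open Scope classical_set_scope.
Local Open Scope ring_scope.

Section NumberField.
Variable R : realType.

(* Q(y): the intersection of all subfields of R containing y. *)
Definition Qadjoin (y : R) : set R :=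
  [set x | forall S : {pred R}, divring_closed S -> y \in S -> x \in S].

Definition ring_of_integers (K : set R) : set R :=
  [set x | K x /\ integralOver (intr : int -> R) x].

Definition unit_group (O : set R) : set R :=
  [set x | O x /\ exists2 y, O y & x * y = 1].

Definition is_coord n (v : 'cV[R]_n) (x : R) (c : 'cV[rat]_n) : Prop :=
  x = \sum_k ratr (c k 0) * v k 0.

Definition Qbasis n (K : set R) (v : 'cV[R]_n) : Prop :=
  [/\ forall i, K (v i 0),
      forall c, is_coord v 0 c -> c = 0
    & forall x, K x -> exists c, is_coord v x c].

(* T is the matrix of f in the basis v, with images as columns; it is unique
   as soon as v is linearly independent over Q. *)
Definition is_mx_in_basis n (v : 'cV[R]_n) (f : R -> R) (T : 'M[rat]_n) : Prop :=
  forall i, is_coord v (f (v i 0)) (col i T).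

End NumberField.

Section MCF.
Variables (R : realType) (n : nat).

Definition posvec (v : 'cV[R]_n) : Prop := forall i, 0 < v i 0.

Record mcf := Mcf {
  mcf_index : countType;
  mcf_cone : mcf_index -> set 'cV[R]_n;
  mcf_mx : mcf_index -> 'M[R]_n;
  mcf_cone_pos : forall j v, mcf_cone j v -> posvec v;
  mcf_cone_disj : forall i j, i != j -> mcf_cone i `&` mcf_cone j = set0;
  mcf_coneZ : forall j (a : R) v, 0 < a -> mcf_cone j v -> mcf_cone j (a *: v);
  mcf_mx_unit : forall j, mcf_mx j \in unitmx;
  (* the empty product is excluded *)
  mcf_mx_prod : forall s : seq mcf_index,
    s != [::] -> \prod_(j <- s) mcf_mx j <> 1%:M
}.

Definition unimodular (alg : mcf) : Prop :=
  forall j : mcf_index alg, mcf_mx j \is a mxOver Num.int /\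
    (\det (mcf_mx j) = 1 \/ \det (mcf_mx j) = -1).

(* The algorithm performs at least m steps on v; w 0, ..., w m are the
   successive vectors v^(i) and A 0, ..., A m.-1 the matrices A^(i). Values of w
   and A at larger indices are irrelevant. *)
Definition mcf_run (alg : mcf) (v : 'cV[R]_n) (m : nat)
    (w : nat -> 'cV[R]_n) (A : nat -> 'M[R]_n) : Prop :=
  w 0%N = v /\
  forall i, (i < m)%N -> exists j : mcf_index alg,
    [/\ mcf_cone j (w i), A i = mcf_mx j & w i.+1 = invmx (A i) *m w i].

(* The expansion of v has preperiod N and period p. *)
Definition mcf_periodic (alg : mcf) (v : 'cV[R]_n) (N p : nat)
    (w : nat -> 'cV[R]_n) (A : nat -> 'M[R]_n) : Prop :=
  [/\ (0 < p)%N, mcf_run alg v (N + p) w A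
    & exists lambda : R, w N = lambda *: w (N + p)%N].

Definition eventually_periodic (alg : mcf) (v : 'cV[R]_n) : Prop :=
  exists N p w A, mcf_periodic alg v N p w A.

Definition matrix_of_repetend (alg : mcf) (v : 'cV[R]_n) (M : 'M[R]_n) : Prop :=
  exists N p w A, mcf_periodic alg v N p w A /\
    let Rm := \prod_(0 <= i < N) A i in
    let Pm := \prod_(N <= i < N + p) A i in
    M = Rm *m Pm *m invmx Rm.

End MCF.

(* Main.v *)
Require Import Defs.
From HB Require Import structures.
From mathcomp Require Import all_boot all_order all_algebra.
From mathcomp Require Import boolp classical_sets reals.

Set Implicit Arguments.
Unset Strict Implicit.
Unset Printing Implicit Defensive.

Import Order.TTheory GRing.Theory Num.Theory.
Local Open Scope ring_scope.

(** If v^(N) = lambda v^(N+p), then v = R v^(N) = R P v^(N+p), so M = R P R^-1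
    satisfies M v = lambda v. Since M lies in GL_n(Z), lambda is a root of the
    characteristic polynomial of an integer matrix, and so is lambda^-1, because
    M^-1 v = lambda^-1 v. The equation M v = lambda v says that M^T is the
    matrix of multiplication by lambda in the basis v. *)

(** The image of GL_n(Z) in the real matrices. Keeping the integer matrix [B] as a witness gives
    access to its characteristic polynomial over the integers. *)
Definition GLZ_mx (R : realType) n (A : 'M[R]_n) : Prop :=
  exists2 B : 'M[int]_n, B \in unitmx & A = map_mx intr B.

Lemma GLZ_mx1 (R : realType) n : GLZ_mx (1%:M : 'M[R]_n).
Proof. by exists 1%:M; rewrite ?unitmx1 ?map_mx1. Qed.

Lemma GLZ_mxM (R : realType) n (A B : 'M[R]_n) :
  GLZ_mx A -> GLZ_mx B -> GLZ_mx (A *m B).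
Proof.
case=> A' uA -> [B' uB ->]; exists (A' *m B'); last by rewrite map_mxM.
by rewrite unitmx_mul uA.
Qed.

Lemma GLZ_mx_unit (R : realType) n (A : 'M[R]_n) : GLZ_mx A -> A \in unitmx.
Proof.
by case=> B uB ->; rewrite unitmxE det_map_mx rmorph_unit // -unitmxE.
Qed.

Lemma GLZ_mxV (R : realType) n (A : 'M[R]_n) : GLZ_mx A -> GLZ_mx (invmx A).
Proof.
move=> GA; have uA := GLZ_mx_unit GA; case: GA => B uB AE.
exists (invmx B); first by rewrite unitmx_inv.
apply: (can_inj (mulKmx uA)).
by rewrite mulmxV // AE -map_mxM mulmxV // map_mx1.
Qed.

Lemma GLZ_mx_prod (R : realType) n (A : nat -> 'M[R]_n.+1) a b :
  (forall i, (i < b)%N -> GLZ_mx (A i)) -> GLZ_mx (\prod_(a <= i < b) A i).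
Proof.
move=> GA; rewrite big_nat.
apply: (big_ind (@GLZ_mx R n.+1)) => [|B C|i /andP[_ /GA]] //.
  exact: GLZ_mx1.
exact: GLZ_mxM.
Qed.

(** Integer entries equal their floors, and the embedding of the integers is injective, so the floor
    matrix has determinant 1 or -1, a unit. *)
Lemma GLZ_mx_of_det (R : realType) n (A : 'M[R]_n) :
  A \is a mxOver Num.int -> \det A = 1 \/ \det A = -1 -> GLZ_mx A.
Proof.
move=> /mxOverP intA detA.
have AE : A = map_mx intr (map_mx Num.floor A).
  by apply/matrixP => i j; rewrite !mxE floorK.
exists (map_mx Num.floor A) => //; move: detA; rewrite [in \det A]AE det_map_mx.
rewrite -(rmorph1 (intr : int -> R)) -rmorphN unitmxE.
by case=> /intr_inj ->; rewrite ?unitrN unitr1.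
Qed.

Lemma integralOver_eigenvalue (R : realType) n (A : 'M[int]_n) (x : 'cV[R]_n)
    (l : R) :
  x != 0 -> map_mx intr A *m x = l *: x -> integralOver (intr : int -> R) l.
Proof.
(* [eigenvalue] refers to row vectors, hence the transposes of [A] and [x]. *)
move=> x0 Axl; exists (char_poly A^T); first exact: char_poly_monic.
rewrite map_char_poly -eigenvalue_root_char; apply/eigenvalueP.
exists x^T; last by rewrite -trmx0 (inj_eq trmx_inj).
by rewrite -map_trmx -trmx_mul Axl linearZ.
Qed.

(** [divring_closed] provides 1, differences and quotients; zero, sums and integer multiples are
    derived from these below. *)
Lemma Qadjoin_div (R : realType) (y a b : R) :
  Qadjoin y a -> Qadjoin y b -> Qadjoin y (a / b).
Proof.
by move=> Ka Kb S dS yS; have [_ _] := dS; apply; [apply: Ka | apply: Kb].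
Qed.

Lemma Qadjoin1 (R : realType) (y : R) : Qadjoin y 1.
Proof. by move=> S [? ? ?]. Qed.

Lemma QadjoinB (R : realType) (y a b : R) :
  Qadjoin y a -> Qadjoin y b -> Qadjoin y (a - b).
Proof.
by move=> Ka Kb S dS yS; have [_ + _] := dS; apply; [apply: Ka | apply: Kb].
Qed.

Lemma Qadjoin0 (R : realType) (y : R) : Qadjoin y 0.
Proof. by rewrite -(subrr 1); apply: QadjoinB; apply: Qadjoin1. Qed.

Lemma QadjoinD (R : realType) (y a b : R) :
  Qadjoin y a -> Qadjoin y b -> Qadjoin y (a + b).
Proof.
move=> Ka Kb; rewrite -[b]opprK; apply: QadjoinB => //.
by rewrite -sub0r; apply: QadjoinB => //; apply: Qadjoin0.
Qed.

Lemma Qadjoin_mulrz (R : realType) (y a : R) (m : int) :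
  Qadjoin y a -> Qadjoin y (a *~ m).
Proof.
move=> Ka.
have Kn k : Qadjoin y (a *+ k).
  by elim: k => [|k IH]; [apply: Qadjoin0 | rewrite mulrS; apply: QadjoinD].
case: m => k; first exact: Kn.
by rewrite NegzE mulrNz -sub0r; apply: QadjoinB; [apply: Qadjoin0 | apply: Kn].
Qed.

(** Row [i] of the eigenvector equation writes [l * x i 0] as an integer combination of the entries
    of [x]; dividing by [x i 0] gives [l]. *)
Lemma Qadjoin_eigenvalue (R : realType) n (y : R) (A : 'M[int]_n)
    (x : 'cV[R]_n) (l : R) i :
  (forall j, Qadjoin y (x j 0)) -> x i 0 != 0 ->
  map_mx intr A *m x = l *: x -> Qadjoin y l.
Proof.
move=> Kx xi0 /matrixP/(_ i 0); rewrite !mxE => Axl.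
rewrite -(mulfK xi0 l) -Axl; apply: Qadjoin_div => //.
apply: (big_ind (Qadjoin y)) => [|a b|j _]; first exact: Qadjoin0.
  exact: QadjoinD.
by rewrite mxE mulrC mulrzr; apply: Qadjoin_mulrz.
Qed.

(** Each step is undone by its matrix: [w k = A k *m w k.+1]. *)
Lemma mcf_run_prod (R : realType) n (alg : mcf R n.+1) (v : 'cV[R]_n.+1) m w A :
  mcf_run alg v m w A ->
  forall k, (k <= m)%N -> v = \prod_(0 <= i < k) A i *m w k.
Proof.
case=> w0 step; elim=> [|k IH] km; first by rewrite big_geq // w0 mul1mx.
have [j [_ Ak wk]] := step k km.
rewrite big_nat_recr //= -mulmxA wk mulKVmx; first by apply: IH; apply: ltnW.
by rewrite Ak mcf_mx_unit.
Qed.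

Lemma repetend_eigenvector (R : realType) n (alg : mcf R n.+1)
    (v : 'cV[R]_n.+1) (M : 'M[R]_n.+1) :
  unimodular alg -> matrix_of_repetend alg v M ->
  GLZ_mx M /\ exists l : R, M *m v = l *: v.
Proof.
move=> uni [N [p [w [A [[_ run [l wl]] /= ->]]]]].
have GA i : (i < N + p)%N -> GLZ_mx (A i).
  case: run => _ step /step [j [_ -> _]].
  by have [intA detA] := uni j; apply: GLZ_mx_of_det.
have GR : GLZ_mx (\prod_(0 <= i < N) A i).
  by apply: GLZ_mx_prod => i iN; apply: GA; apply: ltn_addr.
have GP : GLZ_mx (\prod_(N <= i < N + p) A i) by apply: GLZ_mx_prod.
split; first by apply: GLZ_mxM (GLZ_mxV GR); apply: GLZ_mxM.
(* With R and P the two products, R^-1 v = [w N] = [l *: w (N + p)], and R P [w (N + p)] = v. *)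
exists l; rewrite {1}(mcf_run_prod run (leq_addr p N)) -!mulmxA.
rewrite (mulKmx (GLZ_mx_unit GR)) wl -!scalemxAr mulmxA; congr (_ *: _).
rewrite [RHS](mcf_run_prod run (leqnn _)).
by rewrite (big_cat_nat (leq0n N) (leq_addr p N)).
Qed.

Theorem theorem4p2 (R : realType) (n : nat) (v : 'cV[R]_n.+1)
    (alg : mcf R n.+1) (M : 'M[R]_n.+1) :
  posvec v ->
  Qbasis (Qadjoin (v ord0 0)) v ->
  unimodular alg ->
  eventually_periodic alg v ->
  matrix_of_repetend alg v M ->
  exists2 eps : R,
    unit_group (ring_of_integers (Qadjoin (v ord0 0))) eps &
    exists2 T : 'M[rat]_n.+1,
      is_mx_in_basis v (fun x => eps * x) T &
      M = (map_mx ratr T)^T.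
Proof.
move=> posv [Kv _ _] uni _ /(repetend_eigenvector uni)[GM [l Ml]].
have vi0 : v ord0 0 != 0 by rewrite gt_eqF.
have v0 : v != 0 by apply: contraNneq vi0 => ->; rewrite mxE.
have uM := GLZ_mx_unit GM.
(* If [l] were 0, the invertible matrix [M] would kill the nonzero vector [v]. *)
have l0 : l != 0.
  apply: contra_neq v0 => l0.
  by rewrite -(mulKmx uM v) Ml l0 scale0r mulmx0.
have MVl : invmx M *m v = l^-1 *: v.
  by rewrite -{1}(scalerK l0 v) -scalemxAr -Ml mulKmx.
(* Stated for any matrix, so as to serve both [M] with [l] and [invmx M] with [l^-1]. *)
have OE (B : 'M[R]_n.+1) (a : R) : GLZ_mx B -> B *m v = a *: v ->
    ring_of_integers (Qadjoin (v ord0 0)) a.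
  case=> B' _ -> Ba; split; first exact: Qadjoin_eigenvalue Kv vi0 Ba.
  exact: integralOver_eigenvalue v0 Ba.
exists l.
  split; first exact: OE GM Ml.
  by exists l^-1; [apply: OE (GLZ_mxV GM) MVl | rewrite divff].
(* Row [i] of [M *m v = l *: v] lists the coordinates of [l * v i 0] in the basis; they form column
   [i] of the transpose. *)
case: GM => B _ MB; exists (map_mx intr B)^T.
  move=> i; have /matrixP/(_ i 0) := Ml; rewrite /is_coord !mxE => <-.
  by apply: eq_bigr => k _; rewrite MB !mxE ratr_int.
by apply/matrixP => i j; rewrite MB !mxE ratr_int.
Qed.
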